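(* Let $R$ be a finite commutative ring and let $\Gamma(R,S)=G_R(D)$ be a gcd-graph, where $D=\{\mathcal I_1,\mathcal I_2,\dots,\mathcal I_k\}$ is a set of distinct nonzero principal ideals of $R$. Suppose that $\mathcal I_i=Rx_i$. Then every element $s\in S$ can be written in the form $s=\hat u x_i$ for some $1\le i\le k$ and some $u\in (R/\operatorname{Ann}_R(\mathcal I_i))^\times$, where $\hat u$ is a lift of $u$ in $R^\times$; moreover $u$ is uniquely determined by $s$.
   Context: All rings are associative and unital. For a set $D$ of distinct nonzero principal ideals of $R$, $G_R(D)=\Gamma(R,S)$ is the graph with vertex set $R$ in which $x,y$ are adjacent if and only if $x-y\in S$, where $S=\{s\in R: Rs\in D\}$. For a subset $T\subset R$, $\operatorname{Ann}_R(T)=\{a\in R: at=0\text{ for all }t\in T\}$. *)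

(* Defs.v *)
From HB Require Import structures.
From mathcomp Require Import all_boot all_order all_algebra.

Set Implicit Arguments.
Unset Strict Implicit.
Unset Printing Implicit Defensive.

Import GRing.Theory.
Local Open Scope ring_scope.
Local Open Scope quotient_scope.

(* Rings are only assumed unital, so the zero ring is allowed: this is why the
   "Pz" structures are used. *)

Definition principal_ideal (R : finComPzRingType) (x : R) : {set R} :=
  [set a * x | a : R].

(* A graph on the vertex set V is given by its adjacency relation. *)
Definition cayley_graph (R : finComPzRingType) (S : {set R}) : rel R :=
  fun x y => x - y \in S.

Definition gcd_set (R : finComPzRingType) (D : {set {set R}}) : {set R} :=
  [set s | principal_ideal s \in D].

Definition gcd_graph (R : finComPzRingType) (D : {set {set R}}) : rel R :=
  cayley_graph (gcd_set D).

Lemma cayley_graph_gcdP (R : finComPzRingType) (S : {set R})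
    (D : {set {set R}}) :
  cayley_graph S =2 gcd_graph D <-> S = gcd_set D.
Proof.
split=> [eqG | -> //]; apply/setP=> s.
by have := eqG s 0; rewrite /gcd_graph /cayley_graph subr0.
Qed.

(* GRing.unit is not available on the quotient rings below. *)
Definition is_unit (A : comPzRingType) (u : A) : Prop := exists v, u * v = 1.

Section Annihilator.
Variables (R : finComPzRingType) (T : {set R}).

Definition ann : {pred R} := fun a => [forall t in T, a * t == 0].

Fact ann_zmod_closed : zmod_closed ann.
Proof.
split=> [|a b /'forall_in_eqP a0 /'forall_in_eqP b0]; apply/'forall_in_eqP=> t.
  by rewrite mul0r.
by move=> tT; rewrite mulrBl a0 // b0 // subr0.
Qed.
HB.instance Definition _ := GRing.isZmodClosed.Build R ann ann_zmod_closed.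

Lemma annMl a b : b \in ann -> a * b \in ann.
Proof.
move=> /'forall_in_eqP b0; apply/'forall_in_eqP=> t tT.
by rewrite -mulrA b0 // mulr0.
Qed.

(* The library makes {quot I} a ring only for proper ideals I of nonzero rings,
   while ann is the whole ring when T is included in 0; so the ring structure
   is put on the additive quotient {quot ann}. *)
Definition quot_ann := Quotient.quot ann.
HB.instance Definition _ := GRing.Zmodule.on quot_ann.
HB.instance Definition _ := EqQuotient.on quot_ann.

Definition quot_ann_one : quot_ann := \pi_quot_ann 1.
Definition quot_ann_mul (u v : quot_ann) : quot_ann :=
  \pi_quot_ann (repr u * repr v).

Lemma quot_ann_eqE a b : (\pi_quot_ann a == \pi_quot_ann b) = (a - b \in ann).
Proof. by rewrite -Quotient.idealrBE. Qed.

Lemma quot_ann_piM a b :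
  \pi_quot_ann (a * b) = quot_ann_mul (\pi_quot_ann a) (\pi_quot_ann b).
Proof.
apply/eqP; rewrite quot_ann_eqE.
set a' := repr (\pi_quot_ann a); set b' := repr (\pi_quot_ann b).
have aa' : a - a' \in ann by rewrite -quot_ann_eqE reprK.
have bb' : b - b' \in ann by rewrite -quot_ann_eqE reprK.
have -> : a * b - a' * b' = b * (a - a') + a' * (b - b').
  by rewrite !mulrBr (mulrC b a) (mulrC b a') addrA subrK.
by rewrite (@rpredD _ ann) // annMl.
Qed.

Lemma quot_ann_piD a b :
  \pi_quot_ann (a + b) = \pi_quot_ann a + \pi_quot_ann b.
Proof. exact: Quotient.pi_add. Qed.

Fact quot_ann_mulA : associative quot_ann_mul.
Proof.
elim/quotW=> a; elim/quotW=> b; elim/quotW=> c.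
by rewrite -(quot_ann_piM b c) -(quot_ann_piM a b) -!quot_ann_piM mulrA.
Qed.
Fact quot_ann_mulC : commutative quot_ann_mul.
Proof. by move=> u v; rewrite /quot_ann_mul mulrC. Qed.
Fact quot_ann_mul1 : left_id quot_ann_one quot_ann_mul.
Proof. by elim/quotW=> a; rewrite -quot_ann_piM mul1r. Qed.
Fact quot_ann_mulD : left_distributive quot_ann_mul +%R.
Proof.
elim/quotW=> a; elim/quotW=> b; elim/quotW=> c.
by rewrite -quot_ann_piD -(quot_ann_piM a c) -(quot_ann_piM b c) -quot_ann_piM
           mulrDl quot_ann_piD.
Qed.
HB.instance Definition _ := GRing.Zmodule_isComPzRing.Build quot_ann
  quot_ann_mulA quot_ann_mulC quot_ann_mul1 quot_ann_mulD.

End Annihilator.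

(* Main.v *)
(* Two generators [s], [x] of the same principal ideal satisfy [s = a x] and
   [x = b s], so [ab] fixes [x]. Since [R] is finite, some power [e] of [ab] is
   idempotent, and [a e + (1 - e)] is a unit which also maps [x] to [s].
   Conversely [s] determines the ideal [R s = R x_i], hence [i], and two
   multipliers sending [x_i] to [s] differ by an annihilator of [R x_i]. *)

Require Import Defs.
From HB Require Import structures.
From mathcomp Require Import all_boot all_order all_algebra.

Set Implicit Arguments.
Unset Strict Implicit.
Unset Printing Implicit Defensive.

Import GRing.Theory.
Local Open Scope ring_scope.
Local Open Scope quotient_scope.

(** By pigeonhole the powers of [c] are eventually periodic; an exponent that is a multiple of the
    period and lies past the pre-period then gives an idempotent. *)
Lemma finite_idempotent_power (R : finComPzRingType) (c : R) :
  exists n, c ^+ n.+1 * c ^+ n.+1 = c ^+ n.+1.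
Proof.
have [i [p cip]] : exists i p, c ^+ (i + p.+1) = c ^+ i.
  have /injectivePn[i [j neq_ij eq_c]] :
      ~~ injectiveb (fun i : 'I_#|R|.+1 => c ^+ i).
    by apply/injectiveP=> /leq_card; rewrite card_ord ltnn.
  wlog lt_ij : i j neq_ij eq_c / (i < j)%N.
    move=> IH; case: (ltngtP i j) => [|lt_ji|/val_inj eq_ij]; first exact: IH.
      by apply: (IH j i) => //; rewrite eq_sym.
    by rewrite eq_ij eqxx in neq_ij.
  by exists i, (j - i.+1)%N; rewrite addnS -addSn subnKC.
have cipM m : c ^+ (i + m * p.+1) = c ^+ i.
  elim: m => [|m IHm]; first by rewrite addn0.
  by rewrite mulSn addnA exprD cip -exprD.
(* Here [n.+1] equals [i.+1 * p.+1], a positive multiple of the period [p.+1] that is at least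
   [i]. *)
exists (i + i * p + p)%N.
have -> : (i + i * p + p).+1 = (i + (i * p + p.+1))%N by rewrite -addnS -addnA.
rewrite {2}(_ : i + (i * p + p.+1) = i.+1 * p.+1)%N; last first.
  by rewrite mulSn mulnS [RHS]addnC addnA.
by rewrite -exprD addnAC exprD cipM -exprD.
Qed.

Lemma mem_principal_ideal (R : finComPzRingType) (x : R) :
  x \in principal_ideal x.
Proof. by apply/imsetP; exists 1; rewrite ?mul1r. Qed.

Lemma principal_ideal_unitM (R : finComPzRingType) (u x : R) :
  is_unit u -> principal_ideal (u * x) = principal_ideal x.
Proof.
case=> v uv1; apply/setP=> y; apply/imsetP/imsetP=> -[a _ ->].
  by exists (a * u); rewrite ?mulrA.
by exists (a * v); rewrite // -mulrA (mulrA v) (mulrC v) uv1 mul1r.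
Qed.

Lemma principal_ideal_eq_associated (R : finComPzRingType) (s x : R) :
  principal_ideal s = principal_ideal x ->
  exists2 u, is_unit u & s = u * x.
Proof.
move=> eq_sx.
have /imsetP[a _ s_ax] : s \in principal_ideal x.
  by rewrite -eq_sx mem_principal_ideal.
have /imsetP[b _ x_bs] : x \in principal_ideal s.
  by rewrite eq_sx mem_principal_ideal.
have [n ee] := finite_idempotent_power (a * b).
set e := _ ^+ n.+1 in ee.
have abx : a * b * x = x by rewrite mulrAC -s_ax mulrC -x_bs.
have ex : e * x = x.
  by rewrite /e; elim: n.+1 => [|m IHm]; rewrite ?mul1r // exprSr -mulrA abx.
have e0 : e * (1 - e) = 0 by rewrite mulrBr mulr1 ee subrr.
(* On [R = eR x (1 - e)R] the unit is [a] on the first factor, where [ab] is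
   invertible, and [1] on the second, which annihilates [x]. *)
exists (a * e + (1 - e)); last first.
  by rewrite mulrDl mulrBl mul1r -mulrA ex subrr addr0.
(* Inverse taken factor by factor: on [eR], [b * (a * b) ^+ n] inverts [a] because their product is
   [(a * b) ^+ n.+1 = e]. The cross terms vanish by [e0]. *)
exists (b * (a * b) ^+ n * e + (1 - e)).
have aeb : a * e * (b * (a * b) ^+ n * e) = e.
  rewrite mulrACA ee (_ : a * (b * _) = e) ?ee //.
  by rewrite mulrA -exprS.
rewrite mulrDl (mulrDr (a * e)) (mulrDr (1 - e)) aeb -mulrA e0 mulr0 addr0.
rewrite (mulrC (1 - e)) -(mulrA _ e) e0 mulr0 add0r.
by rewrite mulrBr mulr1 (mulrC _ e) e0 subr0 addrC subrK.
Qed.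

Lemma pi_quot_ann_unit (R : finComPzRingType) (T : {set R}) (u : R) :
  is_unit u -> is_unit (\pi_(quot_ann T) u).
Proof.
case=> v uv1; exists (\pi_(quot_ann T) v).
by rewrite -[LHS]quot_ann_piM uv1.
Qed.

(** The difference [a - b] kills the generator [x], hence by commutativity every [r * x]. *)
Lemma quot_ann_principal_eq (R : finComPzRingType) (x a b : R) :
  a * x = b * x ->
  \pi_(quot_ann (principal_ideal x)) a = \pi_(quot_ann (principal_ideal x)) b.
Proof.
move=> eq_ab; apply/eqP; rewrite quot_ann_eqE.
apply/'forall_in_eqP=> _ /imsetP[r _ ->].
by rewrite mulrCA mulrBl eq_ab subrr mulr0.
Qed.

Theorem corollary2p7 (R : finComPzRingType) (S : {set R}) (D : {set {set R}})
    (hG : cayley_graph S =2 gcd_graph D)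
    (k : nat) (I : 'I_k -> {set R}) (x : 'I_k -> R)
    (hD : D = [set I i | i : 'I_k])
    (I_inj : injective I)
    (I_neq0 : forall i, I i <> [set 0])
    (hI : forall i, I i = principal_ideal (x i)) :
  forall s : R, s \in S ->
    exists! iu : {i : 'I_k & quot_ann (I i)},
      let i := tag iu in
      let u : quot_ann (I i) := tagged iu in
      is_unit u /\
      exists uhat : R,
        [/\ is_unit uhat, \pi_(quot_ann (I i)) uhat = u & s = uhat * x i].
Proof.
(* The neighbours of [0] recover the connection set, so [S] is [gcd_set D]. *)
move=> s; have /cayley_graph_gcdP-> := hG.
rewrite inE hD => /imsetP[i _ sI].
have [u0 u0_unit s_ux] : exists2 u, is_unit u & s = u * x i.
  by apply: principal_ideal_eq_associated; rewrite sI hI.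
exists (Tagged (fun i => quot_ann (I i)) (\pi_(quot_ann (I i)) u0)).
split=> [|[j u] /= [_ [u1 [u1_unit <- s_u1x]]] {u}].
  by split; [exact: pi_quot_ann_unit | exists u0].
have eq_ij : i = j.
  by apply: I_inj; rewrite -sI s_u1x principal_ideal_unitM // -hI.
(* The type of the class depends on the index, so [j] is replaced by [i] before the two classes are
   compared. *)
case: j / eq_ij s_u1x => s_u1x; congr Tagged; rewrite hI.
by apply: quot_ann_principal_eq; rewrite -s_ux.
Qed.
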